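(* Let $P_v(n)$ be defined by $\sum_{n=0}^{\infty}P_v(n)q^n=v(q)$, where $v(q)=\sum_{n=0}^{\infty}\dfrac{q^{(n+1)^2}(-q;q^2)_n}{(q;q^2)_{n+1}}$. Then for every integer $n\ge 0$, $$P_v(2n+1)={P_v}_{(d,e)}(n)-{P_v}_{(d,o)}(n),$$ where ${P_v}_{(d,e)}(n)$ (respectively ${P_v}_{(d,o)}(n)$) denotes the number of partitions of $n$ such that (i) parts congruent to $1,3\pmod 4$ have one colour; (ii) parts congruent to $2\pmod 4$ have two colours; (iii) parts congruent to $0\pmod 4$ are distinct and have one colour; (iv) the number of parts congruent to $0\pmod 4$ is even (respectively odd).
   Context: Notation: $(b;q)_n=\prod_{k=0}^{n-1}(1-bq^k)$. Identities involving $q$ are between formal power series. Saying that a part has $r$ colours means that each part of that size may appear in any of $r$ distinct colours, and parts of the same size with different colours are considered distinct (colour partitions); parts may be repeated unless declared distinct. The empty partition is the only partition of $0$. *)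

(* Defs.v *)
From mathcomp Require Import all_boot all_order all_algebra.

Set Implicit Arguments.
Unset Strict Implicit.
Unset Printing Implicit Defensive.

Import GRing.Theory.
Local Open Scope ring_scope.

(* A formal power series over int is the function nat -> int giving its
   coefficients. *)

(* (b; q)_n, where b and q may be any polynomials in the indeterminate. *)
Definition qpoch (b q : {poly int}) (n : nat) : {poly int} :=
  \prod_(k < n) (1 - b * q ^+ k).

(* The power series p / d, meaningful when d has constant coefficient 1: then
   1/d = \sum_k (1 - d)^k, where the terms with k > N do not contribute to
   the coefficient of degree N. See fps_divP. *)
Definition fps_div (p d : {poly int}) (N : nat) : int :=
  (p * \sum_(k < N.+1) (1 - d) ^+ k)`_N.

(* S = \sum_(n >= 0) F n, in the topology of coefficientwise (eventually
   constant) convergence of formal power series. *)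
Definition is_fps_sum (F : nat -> nat -> int) (S : nat -> int) : Prop :=
  forall N, exists M, forall m, (M <= m)%N -> \sum_(n < m) F n N = S N.

Definition v_term (n : nat) : nat -> int :=
  fps_div ('X^(n.+1 ^ 2)%N * qpoch (- 'X) 'X^2 n) (qpoch 'X 'X^2 n.+1).

Definition ncolours (s : nat) : nat := (if s %% 4 == 2 then 2 else 1)%N.

(* A coloured part (s, c) has size s and colour c; sizes are bounded by the
   partitioned integer n, and every size has at most two colours. *)
Definition cpart (n : nat) := ('I_n.+1 * 'I_2)%type.

(* A partition is a finite multiset of coloured parts, given by multiplicities
   (which cannot exceed n). *)
Definition is_Pv_partition (n : nat) (m : {ffun cpart n -> 'I_n.+1}) : bool :=
  [&& (\sum_p m p * p.1)%N == n,
      [forall p, (0 < m p)%N ==> (0 < p.1)%N && (p.2 < ncolours p.1)%N]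
    & [forall p : cpart n, (4 %| p.1)%N ==> (m p <= 1)%N]].

Definition nparts_mult4 (n : nat) (m : {ffun cpart n -> 'I_n.+1}) : nat :=
  (\sum_(p : cpart n | 4 %| p.1) m p)%N.

Definition Pv_de (n : nat) : nat :=
  #|[set m : {ffun cpart n -> 'I_n.+1} |
      is_Pv_partition m && ~~ odd (nparts_mult4 m)]|.

Definition Pv_do (n : nat) : nat :=
  #|[set m : {ffun cpart n -> 'I_n.+1} |
      is_Pv_partition m && odd (nparts_mult4 m)]|.

Lemma coef_mul_low (a p : {poly int}) (k N : nat) :
  (forall i, (i < k)%N -> a`_i = 0) -> (N < k)%N -> (p * a)`_N = 0.
Proof.
move=> a0 ltNk; rewrite coefM big1 // => i _.
by rewrite a0 ?mulr0 // (leq_ltn_trans (leq_subr _ _)).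
Qed.

Lemma coef_exp_low (a : {poly int}) (k i : nat) :
  a`_0 = 0 -> (i < k)%N -> (a ^+ k)`_i = 0.
Proof.
move=> a0; elim: k i => // k IHk i lti; rewrite exprSr coefM big1 // => j _.
case: (ltnP j k) => [ltjk|lekj]; first by rewrite IHk ?mul0r.
have -> : (i - j = 0)%N by apply/eqP; rewrite subn_eq0 (leq_trans _ lekj).
by rewrite a0 mulr0.
Qed.

Lemma fps_div_stable (p d : {poly int}) (N M : nat) :
  d`_0 = 1 -> (N < M)%N ->
  fps_div p d N = (p * \sum_(k < M) (1 - d) ^+ k)`_N.
Proof.
move=> d0; have a0 : (1 - d)`_0 = 0 by rewrite coefB coef1 d0 subrr.
elim: M => // M IHM; rewrite ltnS leq_eqVlt => /orP[/eqP <- //|ltNM].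
rewrite big_ord_recr /= mulrDr coefD -IHM //.
rewrite (@coef_mul_low _ _ M) ?addr0 // => i ltiM; exact: coef_exp_low.
Qed.

Lemma fps_divP (p d : {poly int}) (N : nat) : d`_0 = 1 ->
  \sum_(i < N.+1) d`_i * fps_div p d (N - i) = p`_N.
Proof.
move=> d0; have a0 : (1 - d)`_0 = 0 by rewrite coefB coef1 d0 subrr.
rewrite (eq_bigr (fun i : 'I_N.+1 =>
    d`_i * (p * \sum_(k < N.+1) (1 - d) ^+ k)`_(N - i))); last first.
  by move=> i _; rewrite (@fps_div_stable _ _ _ N.+1) ?ltnS ?leq_subr.
rewrite -coefM mulrCA.
have -> : d * \sum_(k < N.+1) (1 - d) ^+ k = 1 - (1 - d) ^+ N.+1.
  have := subrX1 (1 - d) N.+1; rewrite addrAC subrr add0r mulNr => /eqP.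
  by rewrite -eqr_oppLR opprB => /eqP.
rewrite mulrBr mulr1 coefB (@coef_mul_low _ _ N.+1) ?subr0 // => i lti.
exact: coef_exp_low.
Qed.

Lemma qpochX_coef0 (n : nat) : (qpoch 'X 'X^2 n)`_0 = 1.
Proof.
rewrite -horner_coef0 /qpoch horner_prod big1 // => k _.
by rewrite !hornerE ?mul0r ?subr0.
Qed.

Lemma v_term_low (n N : nat) : (N < n.+1 ^ 2)%N -> v_term n N = 0.
Proof.
move=> ltN; rewrite /v_term /fps_div -mulrA mulrC.
apply: (@coef_mul_low _ _ (n.+1 ^ 2)) => // i lti.
by rewrite coefXn; case: eqP lti => // ->; rewrite ltnn.
Qed.

Lemma v_term_summable :
  is_fps_sum v_term (fun N => \sum_(n < N.+1) v_term n N).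
Proof.
move=> N; exists N.+1; elim=> // m IHm; rewrite leq_eqVlt.
case/orP=> [/eqP <- //|lem]; rewrite big_ord_recr /= IHm //.
by rewrite v_term_low ?addr0 // (leq_trans (ltnW lem)) // leq_pmull.
Qed.

(* Main.v *)
Require Import Defs.
From mathcomp Require Import all_boot all_order all_algebra.
From mathcomp Require Import ring zify.

(** Why the theorem is true.

    Write Q = q^2 and P = q^4.  Three classical steps turn v(q) into an
    expression in which the odd powers of q can be read off.

    First, v has a second expansion
      v(q) = q \sum_k P^(k(k+1)/2) (-P;P)_k / ((q;P)_(k+1) (q^3;P)_(k+1)),
    the specialisation z = q of an identity in a free variable z which both
    sides satisfy because they obey the same first order Q-difference equation
    relating z to z Q ([inv_second_form], [first_to_second_form]).

    Second, 1 / ((z;p)_(n+1) (z';p)_(n+1)) with z z' = p is expanded in partial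
    fractions ([lerch_bailey]: a Bailey pair with a = p), and the sum over k is
    then done by a limiting case of the q-Gauss sum ([gauss_sum]).  The result
    is the Appell-Lerch sum
      v(q) = q C \sum_(r >= 0) (-1)^r P^(r(r+1))
                  (1/(1 - y_r) + y'_r/(1 - y'_r)),
    where y_r = q^(4r+1), y'_r = q^(4r+3) and C = (-P;P)_oo / (P;P)_oo is a
    series in q^2.

    Third, 1/(1 - y) = (1 + y)/(1 - y^2).  Hence the odd part of v(q) is q C
    times the same sum with q, q^3, P replaced by their squares
    ([lerch_even_odd]), and the partial fraction expansion, read backwards with
    n tending to infinity, shows that this sum is a product
    ([lerch_sum_product]).  Simplified, the odd part of v is q T(q^2) with
      T(q) = (q^4;q^4)_oo / ((q;q^2)_oo (q^2;q^4)_oo^2),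
    and T(q) is the generating function of the coloured partitions, each
    counted with the sign (-1)^(number of parts divisible by 4).

    Convergence is handled without infinite objects.  All identities are between
    rational functions, with explicit remainders; [eqO M x y] says that x and y
    have the same power series expansion below q^M, and every infinite sum or
    product is cut at a bound growing with M. *)

Set Implicit Arguments.
Unset Strict Implicit.
Unset Printing Implicit Defensive.

Import GRing.Theory.
Local Open Scope ring_scope.

(** * Finite identities in a field *)

Definition poch (F : fieldType) (b p : F) (n : nat) : F :=
  \prod_(k < n) (1 - b * p ^+ k).

Lemma poch0 (F : fieldType) (b p : F) : poch b p 0 = 1.
Proof. exact: big_ord0. Qed.

Lemma pochS (F : fieldType) (b p : F) n :
  poch b p n.+1 = poch b p n * (1 - b * p ^+ n).
Proof. exact: big_ord_recr. Qed.

Lemma pochSl (F : fieldType) (b p : F) n :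
  poch b p n.+1 = (1 - b) * poch (b * p) p n.
Proof.
rewrite /poch big_ord_recl mulr1; congr (_ * _); apply: eq_bigr => i _.
by rewrite lift0 exprS mulrA.
Qed.

Lemma poch_neq0 (F : fieldType) (b p : F) n :
  (forall k, 1 - b * p ^+ k != 0) -> poch b p n != 0.
Proof. by move=> h; apply/prodf_neq0 => i _. Qed.

(** The k-th term of the second expansion of the sum over n of
    [first_coef Q z n / (1 - z * Q ^+ n)]. *)
Definition second_form (F : fieldType) (Q z : F) (k : nat) : F :=
  Q ^+ (k ^ 2) * z ^+ k.*2 * poch (- Q ^+ 2) (Q ^+ 2) k / poch z Q k.*2.+2.

(** What is left of 1 / (1 - z) when the expansion of [inv_second_form] is
    stopped before its term of index k. *)
Definition second_form_rem (F : fieldType) (Q z : F) (k : nat) : F :=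
  Q ^+ (k ^ 2) * z ^+ k.*2 * poch (- Q ^+ 2) (Q ^+ 2) k / poch z Q k.*2.+1.

(** If W(y) is the sum of the terms [second_form Q y k], this says that
    W(y) = 1/(1 - y) + Q y (1 + y)/(1 - y) W(y Q): the k-th term of
    W(y) - Q y (1 + y)/(1 - y) W(y Q) is the difference of two consecutive
    remainders, so the sum telescopes. *)
Lemma inv_second_form (F : fieldType) (Q y : F) (K : nat) :
  (forall k, 1 - y * Q ^+ k != 0) ->
  (1 - y)^-1 = \sum_(k < K) second_form Q y k
    - Q * y * (1 + y) / (1 - y) * \sum_(k < K) second_form Q (y * Q) k
    + second_form_rem Q y K.
Proof.
move=> h; have h0 : 1 - y != 0 by have := h 0%N; rewrite mulr1.
elim: K => [|K IH].
  rewrite !big_ord0 /second_form_rem pochS !poch0 !expr0 /=.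
  by rewrite mulr0 subrr add0r !mul1r mulr1.
rewrite !big_ord_recr /= [LHS]IH.
suff -> : second_form_rem Q y K = second_form Q y K
    - Q * y * (1 + y) / (1 - y) * second_form Q (y * Q) K + second_form_rem Q y K.+1.
  by move: (_ / _) (\sum_(i < K) _) (\sum_(i < K) _) => a b c; ring.
have hp n : poch (y * Q) Q n != 0.
  by apply: poch_neq0 => k; rewrite -mulrA -exprS; exact: h.
rewrite /second_form_rem /second_form !doubleS.
have -> : poch (y * Q) Q K.*2.+2
     = poch (y * Q) Q K.*2 * (1 - y * Q ^+ K.*2.+1) * (1 - y * Q ^+ K.*2.+2).
  by rewrite !pochS -!mulrA -!exprS.
have -> : poch y Q K.*2.+3
     = (1 - y) * poch (y * Q) Q K.*2 * (1 - y * Q ^+ K.*2.+1) * (1 - y * Q ^+ K.*2.+2).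
  by rewrite pochSl !pochS -!mulrA -!exprS.
have -> : poch y Q K.*2.+2
     = (1 - y) * poch (y * Q) Q K.*2 * (1 - y * Q ^+ K.*2.+1).
  by rewrite pochSl !pochS -!mulrA -!exprS.
have -> : poch y Q K.*2.+1 = (1 - y) * poch (y * Q) Q K.*2.
  by rewrite pochSl.
rewrite (pochS _ _ K).
have h1 := h K.*2.+1; have h2 := h K.*2.+2; have {}hp := hp K.*2.
have eq1 : (K.+1 ^ 2)%N = (K ^ 2 + K.*2.+1)%N by lia.
have eq2 : (Q ^+ 2) ^+ K = Q ^+ K.*2 by rewrite -exprM mul2n.
rewrite eq1 eq2 exprMn exprD.
move: hp h1 h2; rewrite !exprS.
move: (Q ^+ K.*2) (y ^+ K.*2) (Q ^+ (K ^ 2)) (poch (y * Q) Q K.*2)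
  (poch _ _ K) => a b c d e hd h1 h2.
field.
by rewrite h0 hd h1 h2.
Qed.

(** The ratio of consecutive values is the factor Q y (1 + y)/(1 - y) of the
    difference equation of [inv_second_form], at y = z Q^n. *)
Definition first_coef (F : fieldType) (Q z : F) (n : nat) : F :=
  Q ^+ 'C(n.+1, 2) * z ^+ n * poch (- z) Q n / poch z Q n.

(** Iterating the difference equation of [inv_second_form] m times produces the
    first expansion on the left; both tails on the right are small when m and K
    are large. *)
Lemma first_to_second_form (F : fieldType) (Q z : F) (m K : nat) :
  (forall k, 1 - z * Q ^+ k != 0) ->
  \sum_(n < m) first_coef Q z n / (1 - z * Q ^+ n) =
  \sum_(k < K) second_form Q z k
  - first_coef Q z m * \sum_(k < K) second_form Q (z * Q ^+ m) k
  + \sum_(n < m) first_coef Q z n * second_form_rem Q (z * Q ^+ n) K.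
Proof.
move=> h; elim: m => [|m IH].
  rewrite !big_ord0 /first_coef !poch0 !expr0 !mulr1 /= invr1.
  by rewrite !mul1r subrr addr0.
rewrite big_ord_recr /= IH [in RHS]big_ord_recr /=.
rewrite (@inv_second_form _ Q _ K); last first.
  by move=> k; rewrite -mulrA -exprD.
have -> : first_coef Q z m.+1 = first_coef Q z m *
   (Q * (z * Q ^+ m) * (1 + z * Q ^+ m) / (1 - z * Q ^+ m)).
  have hp : poch z Q m != 0 by apply: poch_neq0.
  rewrite /first_coef binS bin1 exprD !pochS !exprS.
  have hm := h m.
  move: hp hm; move: (poch _ _ _) (poch _ _ _) (Q ^+ m) (z ^+ m) (Q ^+ _).
  by move=> a b c d e ha hb; field; rewrite ha hb.
have -> : z * Q ^+ m.+1 = z * Q ^+ m * Q by rewrite exprSr mulrA.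
move: (\sum_(k < K) second_form Q z k) (\sum_(k < K) second_form Q (z * Q ^+ m) k)
  (\sum_(k < K) second_form Q (z * Q ^+ m * Q) k) (\sum_(n < m) _)
  (first_coef Q z m) (second_form_rem _ _ _) (_ / _) => a b c d e f g.
ring.
Qed.

(** For z z' = p, with y = z p^r and y' = z' p^r, this is
    1/(1 - y) + y'/(1 - y'): the terms of index r and -r-1 of a bilateral
    Appell-Lerch sum, put together. *)
Definition lerch (F : fieldType) (z z' p : F) (r : nat) : F :=
  (1 - p ^+ r.*2.+1) / ((1 - z * p ^+ r) * (1 - z' * p ^+ r)).

(** Partial sums of a very well poised series.  At R = n the right-hand side
    would have a factor 1/(p;p)_(-1) = 0, which is why the sum over all r <= n
    vanishes in [lerch_bailey]. *)
Lemma sum_vwp_partial (F : fieldType) (p : F) (n R : nat) :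
  (forall k, 1 - p ^+ k.+1 != 0) -> (R < n)%N ->
  \sum_(r < R.+1) (-1) ^+ r * p ^+ 'C(r, 2) * (1 - p ^+ r.*2.+1)
      / (poch p p (n - r) * poch p p (n + r).+1) =
  (-1) ^+ R * p ^+ 'C(R.+1, 2) * (1 - p ^+ R.+1)
      / ((1 - p ^+ n) * (poch p p (n - R.+1) * poch p p (n + R).+1)).
Proof.
move=> hp; have hP k : poch p p k != 0.
  by apply: poch_neq0 => i; rewrite -exprS.
elim: R => [|R IH] ltR.
  rewrite big_ord_recr big_ord0 /= add0r !mul1r subn0 subn1 addn0.
  case: n ltR => // n _; rewrite /= [poch p p n.+1]pochS -exprS.
  have := hp n; have := hP n; have := hP n.+2; have := hp 0%N.
  rewrite expr1; move: (poch _ _ n) (poch _ _ n.+2) (p ^+ n.+1) => a b c h1 h2 h3 h4.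
  by field; rewrite h2 h3 h4.
rewrite big_ord_recr /= IH ?(ltnW ltR) // {IH}.
have [m ->] : exists m, n = (m + R.+2)%N by exists (n - R.+2)%N; rewrite subnK.
have -> : (m + R.+2 - R.+1 = m.+1)%N by lia.
have -> : (m + R.+2 - R.+2 = m)%N by lia.
have -> : (m + R.+2 + R.+1 = (m + R.+2 + R).+1)%N by lia.
rewrite (pochS _ _ _.+1) (pochS _ _ m) !binS !bin1 !bin0.
rewrite -!exprS.
have := hp (m + R.+2 + R)%N.+1; have := hp m; have := hP m.
have := hP (m + R.+2 + R).+1.
have := hp (m + R.+1)%N; rewrite -addnS.
have -> : (m + R.+2 + R).+2 = (m + R.+2 + R.+2)%N by lia.
rewrite -addnn -!addnS !exprS !exprD !exprS.
move: (poch _ _ m) (poch _ _ _) (p ^+ m) (p ^+ R) (p ^+ 'C(_, _)) ((-1) ^+ R)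
 => a b c d e f h1 h2 h3 h4 h5.
field.
by rewrite h1 h2 h3 h4 h5.
Qed.

(** Induction on n.  With A_k = (1 - z p^k)(1 - z' p^k) one has
    A_n = (1 - p^(n-r)) (1 - p^(n+r+1)) + p^(n-r) A_r.  Multiplying the expansion
    for n by A_n, the first summand gives back the expansion for n - 1, and the
    second one cancels the denominators A_r and leaves the vanishing sum of
    [sum_vwp_partial]. *)
Lemma lerch_bailey (F : fieldType) (z z' p : F) (n : nat) :
  z * z' = p -> (forall k, 1 - p ^+ k.+1 != 0) ->
  (forall k, 1 - z * p ^+ k != 0) -> (forall k, 1 - z' * p ^+ k != 0) ->
  (poch z p n.+1 * poch z' p n.+1)^-1 =
  \sum_(r < n.+1) (-1) ^+ r * p ^+ 'C(r.+1, 2) * lerch z z' p r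
     / (poch p p (n - r) * poch p p (n + r).+1).
Proof.
move=> zz' hp hz hz'; have hP k : poch p p k != 0.
  by apply: poch_neq0 => i; rewrite -exprS.
elim: n => [|n IH].
  rewrite big_ord_recr big_ord0 /= /lerch !pochS !poch0 !expr0 !expr1 !mulr1 !mul1r.
  have := hp 0%N; have := hz 0%N; have := hz' 0%N; rewrite expr0 !mulr1 expr1.
  by move=> h1 h2 h3; rewrite add0r; field; rewrite h1 h2 h3.
pose A k := (1 - z * p ^+ k) * (1 - z' * p ^+ k).
have hA k : A k != 0 by rewrite mulf_neq0.
apply: (mulfI (hA n.+1)).
transitivity ((poch z p n.+1 * poch z' p n.+1)^-1).
  have h1 : poch z p n.+1 != 0 by apply: poch_neq0.
  have h2 : poch z' p n.+1 != 0 by apply: poch_neq0.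
  rewrite /A (pochS _ _ n.+1) (pochS z' _ n.+1).
  have := hz n.+1; have := hz' n.+1; move: h1 h2.
  move: (poch _ _ _) (poch _ _ _) (_ ^+ _) => a b c h1 h2 h3 h4.
  by field; rewrite h1 h2 h3 h4.
rewrite mulr_sumr.
(* [B r] collects the contributions p^(n+1-r) A_r of the induction step. *)
pose B r := (-1) ^+ r * p ^+ 'C(r, 2) * (1 - p ^+ r.*2.+1)
      / (poch p p (n.+1 - r) * poch p p (n.+1 + r).+1) * p ^+ n.+1.
have step (r : nat) : (r <= n)%N ->
   A n.+1 * ((-1) ^+ r * p ^+ 'C(r.+1, 2) * lerch z z' p r
     / (poch p p (n.+1 - r) * poch p p (n.+1 + r).+1))
  = (-1) ^+ r * p ^+ 'C(r.+1, 2) * lerch z z' p r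
     / (poch p p (n - r) * poch p p (n + r).+1) + B r.
  move=> ler; rewrite /B /A /lerch.
  have [m ->] : exists m, n = (m + r)%N by exists (n - r)%N; rewrite subnK.
  have -> : ((m + r).+1 - r = m.+1)%N by lia.
  have -> : (m + r - r = m)%N by lia.
  rewrite addSn (pochS _ _ m) (pochS _ _ _.+1) -!exprS !binS !bin1.
  have := hp m; have := hz r; have := hz' r.
  have := hP m; have := hP (m + r + r).+1.
  have := hp (m + r + r).+1.
  rewrite -addnn !exprS !exprD -zz'.
  move: (poch _ _ _) (poch _ _ _) ((z * z') ^+ m) ((z * z') ^+ r)
    ((z * z') ^+ 'C(_, _)) ((-1) ^+ r) => a b c d e f.
  move=> h1 h2 h3 h4 h5 h6.
  field.
  by rewrite h1 h2 h3 h4 h5 h6.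
rewrite big_ord_recr /= (eq_bigr _ (fun (r : 'I_n.+1) _ => step r (ltn_ord r))).
rewrite big_split /= -IH.
rewrite -addrA -[LHS]addr0; congr (_ + _); apply/esym.
rewrite -mulr_suml sum_vwp_partial // subnn poch0 mul1r.
rewrite /lerch /A /= addnS (pochS _ _ (n.+1 + n).+1) -exprS.
have := hz n.+1; have := hz' n.+1; have := hp n.
have := hp (n.+1 + n).+1; have := hP (n.+1 + n).+1; move: (poch _ _ _) => a.
have -> : n.+1.*2.+1 = (n.+1 + n).+2 by lia.
rewrite (binS n.+1) bin1 exprD [(-1) ^+ n.+1]exprS.
move: (p ^+ (n.+1 + n).+2) (p ^+ n.+1) (p ^+ 'C(_, _)) ((-1) ^+ n)
  => b c d e h1 h2 h3 h4 h5.
by field; rewrite h1 h2 h3 h4 h5.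
Qed.

(** Up to the power p^(r(r+1)/2), the coefficient of the r-th partial fraction
    in the term of index r + m of the second expansion. *)
Definition gauss_term (F : fieldType) (p : F) (r m : nat) : F :=
  p ^+ ('C(m.+1, 2) + r * m) * poch (- p) p (r + m)
    / (poch p p m * poch p p (r.*2 + m).+1).

(** The sum of [gauss_term p r m] over all m does not depend on r: the
    difference of two consecutive summands telescopes in m (a WZ pair), and the
    right-hand side tends to 0 as L grows. *)
Lemma gauss_shift (F : fieldType) (p : F) (r L : nat) :
  (forall k, 1 - p ^+ k.+1 != 0) ->
  \sum_(m < L) gauss_term p r m - \sum_(m < L) gauss_term p r.+1 m =
  - (gauss_term p r L * (1 - p ^+ L)
      * (1 + p ^+ r.+1 * (1 - p ^+ r.+1) * p ^+ L) / (1 - p ^+ (r.*2 + L).+2)).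
Proof.
move=> hp; have hP k : poch p p k != 0.
  by apply: poch_neq0 => i; rewrite -exprS.
elim: L => [|L IH].
  by rewrite !big_ord0 expr0 !subrr mulr0 !mul0r oppr0.
rewrite !big_ord_recr /= opprD addrACA {}IH /gauss_term.
rewrite doubleS !addSn !addnS !binS !bin0 bin1 !(pochS _ _ (_ + _)).
rewrite !(pochS _ _ _.+1) !(pochS _ _ L) !(pochS _ _ (r.*2 + L)).
have := hP (r.*2 + L)%N; have := hP L; have := hp L; have := hp (r.*2 + L)%N.
have := hp (r.*2 + L).+1; have := hp (r.*2 + L).+2.
move: (poch p p (r.*2 + L)) (poch p p L) (poch (- p) p (r + L)) => a b c.
rewrite !mulnS !mulSn -addnn.
rewrite !(exprS, exprD) -?exprM.
move: (p ^+ 'C(_, _)) (p ^+ r) (p ^+ L) (p ^+ (r * L)) => d e f g h1 h2 h3 h4 h5 h6.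
field.
by rewrite h1 h2 h3 h4 h5 h6.
Qed.

Lemma sum_triangle (V : nmodType) (G : nat -> nat -> V) (K : nat) :
  \sum_(n < K) \sum_(r < n.+1) G r n = \sum_(r < K) \sum_(m < K - r) G r (r + m)%N.
Proof.
elim: K => [|K IH]; first by rewrite !big_ord0.
rewrite big_ord_recr /= IH.
rewrite [RHS](eq_bigr (fun r : 'I_K.+1 => \sum_(m < K - r) G r (r + m)%N + G r K)).
  by rewrite big_split /= [in RHS]big_ord_recr /= subnn big_ord0 addr0.
by move=> r _; rewrite subSn ?leq_ord // big_ord_recr /= subnKC ?leq_ord.
Qed.

Lemma sum_bailey (F : fieldType) (z z' p : F) (K : nat) :
  z * z' = p -> (forall k, 1 - p ^+ k.+1 != 0) ->
  (forall k, 1 - z * p ^+ k != 0) -> (forall k, 1 - z' * p ^+ k != 0) ->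
  \sum_(n < K) p ^+ 'C(n.+1, 2) * poch (- p) p n
     / (poch z p n.+1 * poch z' p n.+1) =
  \sum_(r < K) (-1) ^+ r * p ^+ (r * r.+1) * lerch z z' p r
     * \sum_(m < K - r) gauss_term p r m.
Proof.
move=> zz' hp hz hz'.
pose G r n := p ^+ 'C(n.+1, 2) * poch (- p) p n * ((-1) ^+ r * p ^+ 'C(r.+1, 2)
   * lerch z z' p r / (poch p p (n - r) * poch p p (n + r).+1)).
transitivity (\sum_(n < K) \sum_(r < n.+1) G r n).
  by apply: eq_bigr => n _; rewrite (lerch_bailey n zz') // mulr_sumr.
rewrite sum_triangle; apply: eq_bigr => r _.
rewrite mulr_sumr; apply: eq_bigr => m _.
rewrite /G /gauss_term addKn.
have -> : (r + m + r = r.*2 + m)%N by lia.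
have -> : 'C((r + m).+1, 2) = ('C(r.+1, 2) + ('C(m.+1, 2) + r * m))%N.
  elim: {G}(nat_of_ord m) => [|k IH]; first by rewrite muln0 !addn0.
  rewrite addnS binS IH bin1 (binS k.+1) bin1; lia.
have -> : (r * r.+1 = 'C(r.+1, 2) + 'C(r.+1, 2))%N.
  by elim: (nat_of_ord r) => // k IH; rewrite binS bin1; lia.
rewrite !exprD; move: (_^-1) => a.
move: (p ^+ 'C(r.+1, 2)) (p ^+ 'C(m.+1, 2)) (p ^+ (r * m)) ((-1) ^+ r)
  (poch _ _ _) (lerch _ _ _ _) => *.
ring.
Qed.

(** * Power series expansions of rational functions *)

Local Notation ratfun := {fraction {poly int}}.
Local Notation "p %:F" := (tofrac p).
Definition q : ratfun := 'X%:F.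

(** The ideal q^M of the local ring of rational functions that have a power
    series expansion with integer coefficients. *)
Definition inO (M : nat) (x : ratfun) : Prop :=
  exists a b : {poly int}, b`_0 = 1 /\ x = q ^+ M * a%:F / b%:F.

Lemma tofrac_unit (b : {poly int}) : b`_0 = 1 -> b%:F != 0.
Proof.
by move=> b0; rewrite tofrac_eq0; apply: contra_eqN b0 => /eqP ->; rewrite coef0.
Qed.

Lemma inO_frac (a b : {poly int}) : b`_0 = 1 -> inO 0 (a%:F / b%:F).
Proof. by move=> b0; exists a, b; split=> //; rewrite expr0 mul1r. Qed.

Lemma inO_poly (a : {poly int}) : inO 0 a%:F.
Proof. by have := @inO_frac a 1; rewrite coef1 tofrac1 divr1; apply. Qed.

Lemma inO1 : inO 0 1. Proof. exact: (inO_poly 1). Qed.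

Lemma inO0 M : inO M 0.
Proof. by exists 0, 1; rewrite coef1 tofrac0 mulr0 mul0r. Qed.

Lemma inO_exp M k : (M <= k)%N -> inO M (q ^+ k).
Proof.
move=> le; exists 'X^(k - M), 1; rewrite coef1 tofrac1 divr1; split=> //.
by rewrite tofracXn -exprD subnKC.
Qed.

Lemma inOM M N x y : inO M x -> inO N y -> inO (M + N) (x * y).
Proof.
move=> [a [b [b0 ->]]] [c [d [d0 ->]]]; exists (a * c), (b * d).
rewrite coef0M b0 d0 mulr1; split=> //.
rewrite exprD !tofracM invfM [LHS]mulrACA; congr (_ * _); exact: mulrACA.
Qed.

Lemma inO_le M N x : (N <= M)%N -> inO M x -> inO N x.
Proof.
move=> le [a [b [b0 ->]]]; exists ('X^(M - N) * a), b; split=> //.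
by rewrite tofracM tofracXn !mulrA -exprD subnKC.
Qed.

Lemma inOMr M x y : inO M x -> inO 0 y -> inO M (x * y).
Proof. by move=> hx hy; rewrite -(addn0 M); apply: inOM. Qed.

Lemma inOMl M x y : inO 0 x -> inO M y -> inO M (x * y).
Proof. by move=> hx hy; rewrite -(add0n M); apply: inOM. Qed.

Lemma inOD M x y : inO M x -> inO M y -> inO M (x + y).
Proof.
move=> [a [b [b0 ->]]] [c [d [d0 ->]]]; exists (a * d + c * b), (b * d).
rewrite coef0M b0 d0 mulr1; split=> //.
rewrite -!mulrA -mulrDr; congr (_ * _).
by rewrite addf_div ?tofrac_unit // tofracD !tofracM.
Qed.

Lemma inON M x : inO M x -> inO M (- x).
Proof.
by move=> [a [b [b0 ->]]]; exists (- a), b; split=> //; rewrite tofracN mulrN mulNr.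
Qed.

Lemma inO_sum M (I : Type) (s : seq I) (P : pred I) (f : I -> ratfun) :
  (forall i, P i -> inO M (f i)) -> inO M (\sum_(i <- s | P i) f i).
Proof.
move=> h; elim/big_ind: _ => //; first exact: inO0.
by move=> x y; apply: inOD.
Qed.

Definition eqO M x y := inO M (x - y).

Lemma eqO_refl M x : eqO M x x.
Proof. by rewrite /eqO subrr; apply: inO0. Qed.

Lemma eqO_sym M x y : eqO M x y -> eqO M y x.
Proof. by move/inON; rewrite /eqO opprB. Qed.

Lemma eqO_trans M y x z : eqO M x y -> eqO M y z -> eqO M x z.
Proof. by move=> h1 h2; have := inOD h1 h2; rewrite addrA subrK. Qed.

Lemma eqO_le M N x y : (N <= M)%N -> eqO M x y -> eqO N x y.
Proof. exact: inO_le. Qed.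

Lemma eqOD M x x' y y' : eqO M x x' -> eqO M y y' -> eqO M (x + y) (x' + y').
Proof. by move=> h1 h2; have := inOD h1 h2; rewrite addrACA -opprD. Qed.

Lemma eqO_sum M (I : Type) (s : seq I) (P : pred I) (f g : I -> ratfun) :
  (forall i, P i -> eqO M (f i) (g i)) ->
  eqO M (\sum_(i <- s | P i) f i) (\sum_(i <- s | P i) g i).
Proof. by move=> h; rewrite /eqO -sumrB; apply: inO_sum. Qed.

Lemma eqOM M x x' y y' : inO 0 x -> inO 0 y' ->
  eqO M x x' -> eqO M y y' -> eqO M (x * y) (x' * y').
Proof.
move=> hx hy h1 h2; apply: (@eqO_trans _ (x * y')).
  by rewrite /eqO -mulrBr; apply: inOMl.
by rewrite /eqO -mulrBl; apply: inOMr.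
Qed.

(** The units of the local ring with constant term 1; every product
    1 - q^k or 1 + q^k that gets inverted is one of them. *)
Definition unit1 x := eqO 1 x 1.

Lemma unit1P x : unit1 x -> [/\ x != 0, inO 0 x & inO 0 x^-1].
Proof.
move=> [a [b [b0 hx]]].
have {hx} -> : x = ('X * a + b)%:F / b%:F.
  rewrite -[x](subrK 1) hx expr1 tofracD tofracM mulrDl divff //.
  exact: tofrac_unit.
have c0 : ('X * a + b)`_0 = 1 by rewrite coefD coefXM b0 add0r.
split; last by rewrite invf_div; apply: inO_frac.
  by rewrite mulf_neq0 ?invr_eq0 // tofrac_unit.
exact: inO_frac.
Qed.

Lemma unit1_neq0 x : unit1 x -> x != 0. Proof. by case/unit1P. Qed.
Lemma unit1_inO x : unit1 x -> inO 0 x. Proof. by case/unit1P. Qed.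
Lemma unit1V_inO x : unit1 x -> inO 0 x^-1. Proof. by case/unit1P. Qed.

Lemma unit1M x y : unit1 x -> unit1 y -> unit1 (x * y).
Proof.
move=> hx hy; rewrite /unit1 -[1]mulr1; apply: eqOM => //; first exact: unit1_inO.
exact: inO1.
Qed.

Lemma unit1X x k : unit1 x -> unit1 (x ^+ k).
Proof.
move=> hx; elim: k => [|k IH]; first exact: eqO_refl.
by rewrite exprS; apply: unit1M.
Qed.

Lemma unit1V x : unit1 x -> unit1 x^-1.
Proof.
move=> hx; have x0 := unit1_neq0 hx.
rewrite /unit1 /eqO.
have -> : x^-1 - 1 = (1 - x) * x^-1 by rewrite mulrBl divff // mul1r.
by apply: inOMr; [exact: eqO_sym | exact: unit1V_inO].
Qed.

Lemma unit1_prod (I : Type) (s : seq I) (P : pred I) (f : I -> ratfun) :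
  (forall i, P i -> unit1 (f i)) -> unit1 (\prod_(i <- s | P i) f i).
Proof.
move=> h; elim/big_ind: _ => //; first exact: eqO_refl.
by move=> x y; apply: unit1M.
Qed.

Lemma eqOV M x y : unit1 x -> unit1 y -> eqO M x y -> eqO M x^-1 y^-1.
Proof.
move=> hx hy h; have x0 := unit1_neq0 hx; have y0 := unit1_neq0 hy.
rewrite /eqO; have -> : x^-1 - y^-1 = (y - x) * (x^-1 * y^-1).
  by rewrite mulrBl mulrCA divff // mulr1 mulrA divff // mul1r.
apply: inOMr; first exact: eqO_sym.
by apply: (@inOM 0 0); apply: unit1V_inO.
Qed.

Lemma eqO_1Bexp M k : (M <= k)%N -> eqO M (1 - q ^+ k) 1.
Proof. by move=> h; rewrite /eqO addrAC subrr add0r; apply: inON; apply: inO_exp. Qed.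

Lemma unit1_1Bexp k : (0 < k)%N -> unit1 (1 - q ^+ k).
Proof. exact: eqO_1Bexp. Qed.

Lemma unit1_1Dexp k : (0 < k)%N -> unit1 (1 + q ^+ k).
Proof. by move=> h; rewrite /unit1 /eqO addrAC subrr add0r; apply: inO_exp. Qed.

Lemma unit1_poch a c n : (0 < a)%N -> unit1 (poch (q ^+ a) (q ^+ c) n).
Proof.
move=> h; apply: unit1_prod => i _; rewrite -exprM -exprD.
by apply: unit1_1Bexp; rewrite addn_gt0 h.
Qed.

Lemma unit1_pochN a c n : (0 < a)%N -> unit1 (poch (- q ^+ a) (q ^+ c) n).
Proof.
move=> h; apply: unit1_prod => i _; rewrite mulNr opprK -exprM -exprD.
by apply: unit1_1Dexp; rewrite addn_gt0 h.
Qed.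

Lemma poly_low (p : {poly int}) M : (forall i, (i < M)%N -> p`_i = 0) ->
  exists r, p = 'X^M * r.
Proof.
move=> h; exists (drop_poly M p); rewrite -[LHS](poly_take_drop M) mulrC.
rewrite [take_poly _ _](_ : _ = 0) ?add0r //.
by apply/polyP => i; rewrite coef_take_poly coef0; case: ltnP => // /h.
Qed.

(** Congruence of rational functions determines coefficients: the link back
    from the field of fractions to power series. *)
Lemma inO_polyP (p : {poly int}) M i : inO M p%:F -> (i < M)%N -> p`_i = 0.
Proof.
move=> [a [b [b0]]] /eqP; rewrite -[_ / _]mulrC eq_sym.
rewrite (can2_eq (mulKf _) (mulVKf _)) ?invr_eq0 ?tofrac_unit // invrK.
rewrite -tofracXn -!tofracM tofrac_eq => /eqP e.
elim/ltn_ind: i => i IH ltiM.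
have := congr1 (fun f : {poly int} => f`_i) e; rewrite coefXnM ltiM coefM big_ord_recl.
rewrite subn0 b0 mul1r big1 ?addr0 // => j _.
by rewrite lift0 IH ?mulr0 //; have := ltn_ord j; lia.
Qed.

Lemma fps_div_eqO (a b : {poly int}) M : b`_0 = 1 ->
  eqO M (a%:F / b%:F) (\sum_(i < M) fps_div a b i *: 'X^i)%:F.
Proof.
move=> b0; set h := \sum_(i < M) _.
have hc i : (i < M)%N -> h`_i = fps_div a b i.
  by move=> lt; rewrite /h -(poly_def M (fps_div a b)) coef_poly lt.
have [r hr] : exists r, a - b * h = 'X^M * r.
  apply: poly_low => i lti; rewrite coefB coefM -(fps_divP a i b0).
  apply/eqP; rewrite subr_eq0; apply/eqP; apply: eq_bigr => j _.
  by rewrite hc // (leq_ltn_trans (leq_subr _ _)).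
exists r, b; split=> //; rewrite -tofracXn -tofracM -hr tofracB tofracM mulrBl.
by rewrite mulrAC divff ?mul1r // tofrac_unit.
Qed.

Lemma sum_fps_div (num den : nat -> {poly int}) m h N :
  (forall n, (den n)`_0 = 1) ->
  eqO N.+1 (\sum_(n < m) (num n)%:F / (den n)%:F) h%:F ->
  \sum_(n < m) fps_div (num n) (den n) N = h`_N.
Proof.
move=> hd hS.
have h1 := eqO_sum (index_enum 'I_m) (P := xpredT)
  (fun i _ => fps_div_eqO (num (nat_of_ord i)) N.+1 (hd i)).
have := eqO_trans (eqO_sym hS) h1.
rewrite -rmorph_sum /eqO -tofracB => /inO_polyP/(_ (ltnSn N)).
rewrite coefB coef_sum => /eqP; rewrite subr_eq0 => /eqP ->.
apply: eq_bigr => i _.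
by rewrite -(poly_def N.+1 (fps_div (num i) (den i))) coef_poly ltnSn.
Qed.

(** * The series v as an Appell-Lerch sum *)

Lemma tofrac_qpoch (b p : {poly int}) n : (qpoch b p n)%:F = poch b%:F p%:F n.
Proof.
rewrite rmorph_prod; apply: eq_bigr => k _.
by rewrite /= tofracB tofrac1 tofracM tofracXn.
Qed.

Definition v_num (n : nat) : {poly int} := 'X^(n.+1 ^ 2)%N * qpoch (- 'X) 'X^2 n.
Definition v_den (n : nat) : {poly int} := qpoch 'X 'X^2 n.+1.

Lemma v_termE n :
  (v_num n)%:F / (v_den n)%:F
  = q * (first_coef (q ^+ 2) q n / (1 - q * (q ^+ 2) ^+ n)).
Proof.
rewrite /v_num /v_den tofracM !tofrac_qpoch tofracN !tofracXn -/q pochS /first_coef.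
have -> : (n.+1 ^ 2 = 1 + (2 * 'C(n.+1, 2) + n))%N.
  by elim: n => // n IH; rewrite binS bin1; lia.
by rewrite (exprD q 1) expr1 (exprD q (2 * _)) exprM -!mulrA invfM.
Qed.

Lemma oneBq_neq0 a c k : (0 < a)%N -> 1 - q ^+ a * (q ^+ c) ^+ k != 0.
Proof.
move=> h; apply: unit1_neq0; rewrite -exprM -exprD; apply: unit1_1Bexp.
by rewrite addn_gt0 h.
Qed.

Lemma oneBq_neq0' c k : (0 < c)%N -> 1 - (q ^+ c) ^+ k.+1 != 0.
Proof.
move=> h; apply: unit1_neq0; rewrite -exprM.
by apply: unit1_1Bexp; rewrite muln_gt0 h.
Qed.

Lemma inO_natexp x k : inO 0 x -> inO 0 (x ^+ k).
Proof.
move=> h; elim: k => [|k IH]; first exact: inO1.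
by rewrite exprS; apply: (@inOM 0 0).
Qed.

Lemma inO_sign r : inO 0 ((-1) ^+ r).
Proof. by apply/inO_natexp/inON/inO1. Qed.

(** Membership in the local ring, by following the shape of the expression;
    leaves the positivity of the exponents in the denominators. *)
Ltac local_ring :=
  repeat lazymatch goal with
  | |- inO 0 (_ * _) => apply: (@inOM 0 0)
  | |- inO 0 (_ + _) => apply: inOD
  | |- inO 0 (- _) => apply: inON
  | |- inO 0 (_^-1) => apply: unit1V_inO
  | |- inO 0 (poch _ _ _) => apply: unit1_inO
  | |- inO 0 1 => exact: inO1
  | |- inO 0 q => exact: inO_poly
  | |- inO 0 (q ^+ _) => exact: inO_exp
  | |- inO 0 ((-1) ^+ _) => exact: inO_sign
  | |- inO 0 (_ ^+ _) => apply: inO_natexp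
  | |- unit1 (_ * _) => apply: unit1M
  | |- unit1 (_ ^+ _) => apply: unit1X
  | |- unit1 (_^-1) => apply: unit1V
  | |- unit1 (poch (- _) _ _) => apply: unit1_pochN
  | |- unit1 (poch _ _ _) => apply: unit1_poch
  | |- unit1 (1 - _) => apply: unit1_1Bexp
  end.

Lemma inO_second_form_rem a K : (0 < a)%N -> inO K (second_form_rem (q ^+ 2) (q ^+ a) K).
Proof.
move=> ha; rewrite /second_form_rem -!mulrA -!exprM; apply: inOMr; last by local_ring.
by apply: inO_exp; rewrite -mulnn; nia.
Qed.

Lemma inO_second_form a k : (0 < a)%N -> inO 0 (second_form (q ^+ 2) (q ^+ a) k).
Proof. by move=> ha; rewrite /second_form -!exprM; local_ring. Qed.

Lemma inO_first_coef m : inO m (first_coef (q ^+ 2) q m).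
Proof.
rewrite /first_coef -!mulrA -!exprM; apply: inOMl; first exact: inO_exp.
apply: inOMr; first exact: inO_exp.
by rewrite -{1 3}(expr1 q); local_ring.
Qed.

Lemma v_second_form K :
  eqO K (\sum_(n < K) (v_num n)%:F / (v_den n)%:F)
        (q * \sum_(k < K) second_form (q ^+ 2) q k).
Proof.
have -> : \sum_(n < K) (v_num n)%:F / (v_den n)%:F =
   q * \sum_(n < K) first_coef (q ^+ 2) q n / (1 - q * (q ^+ 2) ^+ n).
  by rewrite mulr_sumr; apply: eq_bigr => n _; rewrite v_termE.
have hq n : q * (q ^+ 2) ^+ n = q ^+ (n.*2.+1).
  by rewrite -exprM mul2n -exprS.
rewrite /eqO -mulrBr; apply: inOMl; first exact: inO_poly.
rewrite (@first_to_second_form _ _ _ K K); last first.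
  by move=> k; have := @oneBq_neq0 1 2 k; rewrite expr1; apply.
rewrite addrC -[X in _ + X]addrA addKr; apply: inOD.
  apply: inON; apply: inOMr; first exact: inO_first_coef.
  by apply: inO_sum => k _; rewrite hq; apply: inO_second_form.
apply: inO_sum => n _; apply: inOMl; first by apply: inO_le (inO_first_coef n).
by rewrite hq; apply: inO_second_form_rem.
Qed.

Lemma inO_gauss_term c r m : (0 < c)%N ->
  inO (m + r * m) (gauss_term (q ^+ c) r m).
Proof.
move=> hc; rewrite /gauss_term -mulrA -exprM; apply: inOMr.
  by apply: inO_exp; rewrite binS bin1; nia.
by local_ring.
Qed.

Lemma gauss_sum_shift c r t L : (0 < c)%N ->
  eqO L (\sum_(m < L) gauss_term (q ^+ c) r m)
        (\sum_(m < L) gauss_term (q ^+ c) (r + t) m).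
Proof.
move=> hc; elim: t => [|t IH]; first by rewrite addn0; exact: eqO_refl.
apply: eqO_trans IH _; rewrite addnS /eqO gauss_shift; last first.
  by move=> k; apply: oneBq_neq0'.
apply/inON/inOMr; first (apply/inOMr; first apply/inOMr).
- by apply: inO_le (inO_gauss_term _ _ hc); rewrite leq_addr.
- by rewrite -!exprM; local_ring.
- by rewrite -!exprM; local_ring.
- by rewrite -!exprM; local_ring; rewrite muln_gt0 hc.
Qed.

Definition gauss_lim (c K : nat) : ratfun :=
  poch (- q ^+ c) (q ^+ c) K / poch (q ^+ c) (q ^+ c) K.*2.+1.

Lemma unit1_gauss_lim c K : (0 < c)%N -> unit1 (gauss_lim c K).
Proof.
by move=> hc; apply: unit1M; [exact: unit1_pochN | exact/unit1V/unit1_poch].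
Qed.

(** By [gauss_shift] the index r may be raised to K without changing the sum
    modulo q^(K - r); for r = K all terms but the first are negligible. *)
Lemma gauss_sum c r K : (0 < c)%N -> (r < K)%N ->
  eqO (K - r) (\sum_(m < K - r) gauss_term (q ^+ c) r m) (gauss_lim c K).
Proof.
move=> hc lt; have := gauss_sum_shift r (K - r) (K - r) hc.
rewrite (subnKC (ltnW lt)) => h; apply: eqO_trans h _.
have [L eL] : exists L, (K - r = L.+1)%N.
  by exists (K - r).-1; rewrite prednK // subn_gt0.
rewrite eL big_ord_recl /= /eqO addrAC.
have -> : gauss_term (q ^+ c) K 0 - gauss_lim c K = 0.
  by rewrite /gauss_term /gauss_lim !muln0 !addn0 poch0 mul1r /= expr0 mul1r subrr.
rewrite add0r; apply: inO_sum => m _; rewrite /bump leq0n add1n.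
by apply: inO_le (inO_gauss_term _ _ hc); nia.
Qed.

Lemma unit1_lerch a b c r : (0 < a)%N -> (0 < b)%N -> (0 < c)%N ->
  unit1 (lerch (q ^+ a) (q ^+ b) (q ^+ c) r).
Proof.
by move=> *; rewrite /lerch -!exprM -!exprD; local_ring; rewrite ?muln_gt0; lia.
Qed.

(** The sum over m that multiplies the r-th term is only known modulo q^(K - r),
    but the factor p^(r(r+1)) supplies the missing q^r. *)
Lemma sum_bailey_lim a b K : (0 < a)%N -> (0 < b)%N ->
  eqO K (\sum_(n < K) (q ^+ (a + b)) ^+ 'C(n.+1, 2)
           * poch (- q ^+ (a + b)) (q ^+ (a + b)) n
           / (poch (q ^+ a) (q ^+ (a + b)) n.+1 * poch (q ^+ b) (q ^+ (a + b)) n.+1))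
        (gauss_lim (a + b) K * \sum_(r < K) (-1) ^+ r * (q ^+ (a + b)) ^+ (r * r.+1)
           * lerch (q ^+ a) (q ^+ b) (q ^+ (a + b)) r).
Proof.
move=> ha hb; have hc : (0 < a + b)%N by lia.
rewrite (@sum_bailey _ _ (q ^+ b)) -?exprD //; first last.
- by move=> k; apply: oneBq_neq0.
- by move=> k; apply: oneBq_neq0.
- by move=> k; apply: oneBq_neq0'.
rewrite mulr_sumr; apply: eqO_sum => r _; rewrite [gauss_lim _ _ * _]mulrC /eqO -mulrBr.
rewrite -{1}(subnKC (ltnW (ltn_ord r))) -exprM; apply: inOM; last exact: gauss_sum.
apply: inOMr; last by apply/unit1_inO/unit1_lerch.
by apply: inOMl; [exact: inO_sign | apply: inO_exp; nia].
Qed.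

Lemma eqO_poch c m n : (0 < c)%N -> (m <= n)%N ->
  eqO m.+1 (poch (q ^+ c) (q ^+ c) n) (poch (q ^+ c) (q ^+ c) m).
Proof.
move=> hc; elim: n => [|n IH]; first by rewrite leqn0 => /eqP ->; exact: eqO_refl.
rewrite leq_eqVlt => /orP[/eqP <-|lt]; first exact: eqO_refl.
apply: eqO_trans (IH lt); rewrite pochS -[X in eqO _ _ X]mulr1.
apply: eqOM; [by local_ring | exact: inO1 | exact: eqO_refl |].
by rewrite -exprM -exprD; apply: eqO_1Bexp; nia.
Qed.

(** This is [lerch_bailey] for n = K - 1: in the r-th term
    (p;p)_(n-r) (p;p)_(n+r+1) may be replaced by (p;p)_K^2 modulo q^(K - r),
    and p^(r(r+1)/2) again supplies q^r. *)
Lemma lerch_sum_product a b K : (0 < a)%N -> (0 < b)%N ->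
  eqO K (\sum_(r < K) (-1) ^+ r * (q ^+ (a + b)) ^+ 'C(r.+1, 2)
           * lerch (q ^+ a) (q ^+ b) (q ^+ (a + b)) r)
        (poch (q ^+ (a + b)) (q ^+ (a + b)) K ^+ 2
          / (poch (q ^+ a) (q ^+ (a + b)) K * poch (q ^+ b) (q ^+ (a + b)) K)).
Proof.
move=> ha hb; have hc : (0 < a + b)%N by lia.
case: K => [|K].
  by rewrite /eqO big_ord0 add0r; local_ring.
rewrite (@lerch_bailey _ _ (q ^+ b)) -?exprD //; first last.
- by move=> k; apply: oneBq_neq0.
- by move=> k; apply: oneBq_neq0.
- by move=> k; apply: oneBq_neq0'.
rewrite mulr_sumr; apply: eqO_sum => r _.
rewrite [X in eqO _ _ X]mulrCA /eqO -{1}[X in X - _]mulr1 -mulrBr.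
have lt := ltn_ord r; rewrite -[in inO _](subnKC (ltnW lt)); apply: inOM.
  apply: inOMr; last by apply/unit1_inO/unit1_lerch.
  rewrite -exprM; apply: inOMl; [exact: inO_sign | apply: inO_exp].
  by rewrite binS bin1; nia.
have hP m : unit1 (poch (q ^+ (a + b)) (q ^+ (a + b)) m) by local_ring.
apply: eqO_sym.
rewrite -[X in eqO _ _ X](@divff _ (poch (q ^+ (a + b)) (q ^+ (a + b)) K.+1 ^+ 2));
  last first.
  by rewrite expf_neq0 // unit1_neq0.
apply: eqOM; [by local_ring | by local_ring | exact: eqO_refl |].
apply: eqOV; [by local_ring | by local_ring |].
apply: eqOM; [by local_ring | by local_ring | | ].
  by apply: eqO_sym; apply: eqO_le (@eqO_poch _ (K - r) _ _ _); rewrite // ?subSn; lia.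
by apply: eqO_le (@eqO_poch _ K.+1 _ _ _); lia.
Qed.

(** * Even and odd powers of q *)

Lemma poch_double (F : fieldType) (b p : F) n :
  poch b p n.*2 = poch b (p ^+ 2) n * poch (b * p) (p ^+ 2) n.
Proof.
elim: n => [|n IH]; first by rewrite !poch0 mulr1.
rewrite doubleS !pochS IH -!exprM mul2n (exprS p n.*2).
move: (poch b _ _) (poch (b * p) _ _) (p ^+ n.*2) => *.
ring.
Qed.

Lemma second_formE k : second_form (q ^+ 2) q k =
  (q ^+ 4) ^+ 'C(k.+1, 2) * poch (- q ^+ 4) (q ^+ 4) k
    / (poch (q ^+ 1) (q ^+ 4) k.+1 * poch (q ^+ 3) (q ^+ 4) k.+1).
Proof.
rewrite /second_form -doubleS poch_double -exprS -exprM -!exprM -exprD expr1.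
have -> : (2 * k ^ 2 + k.*2 = 4 * 'C(k.+1, 2))%N; last by [].
by elim: k => // k IH; rewrite binS bin1; lia.
Qed.

(** From 1/(1 - y) = (1 + y)/(1 - y^2) at y = z p^r and y = z' p^r.  For z = q,
    z' = q^3 and p = q^4 the first summand is even in q and the second is odd. *)
Lemma lerch_even_odd (F : fieldType) (z z' p : F) r : z * z' = p ->
  1 - (z * p ^+ r) ^+ 2 != 0 -> 1 - (z' * p ^+ r) ^+ 2 != 0 ->
  lerch z z' p r = lerch (z ^+ 2) (z' ^+ 2) (p ^+ 2) r
    + (z * p ^+ r / (1 - (z * p ^+ r) ^+ 2) + z' * p ^+ r / (1 - (z' * p ^+ r) ^+ 2)).
Proof.
move=> zz'; rewrite /lerch -!exprM ![(2 * _)%N]mulnC !exprM -!exprMn.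
have -> : p ^+ r.*2.+1 = (z * p ^+ r) * (z' * p ^+ r).
  by rewrite mulrACA zz' -exprD addnn -exprS.
have e x : (1 - x ^+ 2 = (1 - x) * (1 + x) :> F) by rewrite -subr_sqr expr1n.
rewrite !e; move: (z * _) (z' * _) => x y; rewrite !mulf_eq0 !negb_or.
by case/andP=> h1 h2; case/andP=> h3 h4; field; rewrite h1 h2 h3 h4.
Qed.

Definition evenO M x := exists h : {poly int}, eqO M x (h \Po 'X^2)%:F.

Lemma evenO_inO M x : evenO M x -> inO 0 x.
Proof.
move=> [h hh]; rewrite -[x](subrK (h \Po 'X^2)%:F).
by apply: inOD; [apply: inO_le hh | apply: inO_poly].
Qed.

Lemma evenO1 M : evenO M 1.
Proof. by exists 1; rewrite rmorph1 tofrac1; apply: eqO_refl. Qed.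

Lemma evenO_exp M k : ~~ odd k -> evenO M (q ^+ k).
Proof.
move=> ev; exists 'X^(k./2); rewrite rmorphXn /= comp_polyX -exprM mul2n.
by rewrite even_halfK // tofracXn; apply: eqO_refl.
Qed.

Lemma evenON M x : evenO M x -> evenO M (- x).
Proof.
move=> [h hh]; exists (- h); rewrite rmorphN tofracN /eqO -opprD; exact: inON.
Qed.

Lemma evenOD M x y : evenO M x -> evenO M y -> evenO M (x + y).
Proof.
by move=> [h hh] [g hg]; exists (h + g); rewrite rmorphD tofracD; apply: eqOD.
Qed.

Lemma evenOM M x y : evenO M x -> evenO M y -> evenO M (x * y).
Proof.
move=> hx [g hg]; have hx0 := evenO_inO hx; case: hx => h hh.
exists (h * g); rewrite rmorphM tofracM; apply: eqOM => //; exact: inO_poly.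
Qed.

Lemma evenO_sum M (I : Type) (s : seq I) (P : pred I) (f : I -> ratfun) :
  (forall i, P i -> evenO M (f i)) -> evenO M (\sum_(i <- s | P i) f i).
Proof.
move=> h; elim/big_ind: _ => //; last by move=> x y; apply: evenOD.
by exists 0; rewrite rmorph0 tofrac0; apply: eqO_refl.
Qed.

Lemma evenO_prod M (I : Type) (s : seq I) (P : pred I) (f : I -> ratfun) :
  (forall i, P i -> evenO M (f i)) -> evenO M (\prod_(i <- s | P i) f i).
Proof.
move=> h; elim/big_ind: _ => //; last by move=> x y; apply: evenOM.
exact: evenO1.
Qed.

Lemma evenOX M x k : evenO M x -> evenO M (x ^+ k).
Proof.
by move=> hx; elim: k => [|k IH]; [exact: evenO1 | rewrite exprS; exact: evenOM].
Qed.

(** The inverse of x is the geometric series in 1 - x. *)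
Lemma evenOV M x : unit1 x -> evenO M x -> evenO M x^-1.
Proof.
move=> ux hx; have x0 := unit1_neq0 ux.
have [h hh] : evenO M (\sum_(i < M) (1 - x) ^+ i).
  by apply: evenO_sum => i _; apply/evenOX/evenOD; [exact: evenO1 | exact: evenON].
exists h; apply: eqO_trans hh; rewrite /eqO.
have -> : x^-1 - \sum_(i < M) (1 - x) ^+ i = x^-1 * (1 - x) ^+ M.
  apply: (mulfI x0); rewrite mulrBr divff // mulrA divff // mul1r.
  have := subrX1 (1 - x) M; rewrite addrAC subrr add0r mulNr => /eqP.
  by rewrite -eqr_oppLR opprB => /eqP <-; rewrite subKr.
apply: inOMl; first exact: unit1V_inO.
elim: {h hx} M => [|k IH]; first exact: inO1.
by rewrite exprS -add1n; apply: inOM IH; apply: eqO_sym.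
Qed.

Lemma evenO_poch M a c n : ~~ odd a -> ~~ odd c -> evenO M (poch (q ^+ a) (q ^+ c) n).
Proof.
move=> ea ec; apply: evenO_prod => k _; apply: evenOD; first exact: evenO1.
rewrite -exprM -exprD; apply/evenON/evenO_exp.
by rewrite oddD oddM (negPf ea) (negPf ec).
Qed.

Lemma evenO_pochN M a c n : ~~ odd a -> ~~ odd c ->
  evenO M (poch (- q ^+ a) (q ^+ c) n).
Proof.
move=> ea ec; apply: evenO_prod => k _; apply: evenOD; first exact: evenO1.
rewrite mulNr opprK -exprM -exprD; apply/evenO_exp.
by rewrite oddD oddM (negPf ea) (negPf ec).
Qed.

(** The odd part of v(q) divided by q, as a product cut at K. *)
Definition odd_part (K : nat) : ratfun :=
  gauss_lim 4 K * (poch (q ^+ 8) (q ^+ 8) K ^+ 2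
          / (poch (q ^+ 2) (q ^+ 8) K * poch (q ^+ 6) (q ^+ 8) K)).

(** The factor q in front of the Appell-Lerch sum makes its even terms
    the odd part of v, and its odd terms contribute to e. *)
Lemma v_even_odd K : exists2 e, evenO K e &
  eqO K (\sum_(n < K) (v_num n)%:F / (v_den n)%:F) (q * odd_part K + q ^+ 2 * e).
Proof.
pose s r : ratfun := (-1) ^+ r * (q ^+ 4) ^+ (r * r.+1).
(* [q * o a r] is y/(1 - y^2) for y = q^(a+4r), with a = 1 or 3. *)
pose o a r := q ^+ (a - 1) * (q ^+ 4) ^+ r / (1 - (q ^+ a * (q ^+ 4) ^+ r) ^+ 2).
have un a r : (0 < a)%N -> unit1 (1 - (q ^+ a * (q ^+ 4) ^+ r) ^+ 2).
  by move=> ha; rewrite -!exprM -exprD -exprM; apply: unit1_1Bexp; lia.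
have eo a r : odd a -> evenO K (o a r).
  move=> oa; apply: evenOM.
    by rewrite -exprM -exprD; apply: evenO_exp; lia.
  apply: evenOV; first by apply: un; lia.
  apply: evenOD; first exact: evenO1.
  by rewrite -!exprM -exprD -exprM; apply/evenON/evenO_exp; lia.
have es : evenO K (\sum_(r < K) s r * (o 1 r + o 3 r)).
  apply: evenO_sum => r _; apply: evenOM; last by apply: evenOD; apply: eo.
  apply: evenOM; first by apply/evenOX/evenON/evenO1.
  by apply/evenOX/evenO_exp.
have ev : evenO K (gauss_lim 4 K * \sum_(r < K) s r * (o 1 r + o 3 r)).
  apply: evenOM es.
  apply: evenOM; first exact: evenO_pochN.
  by apply: evenOV; [exact: unit1_poch | exact: evenO_poch].
exists (gauss_lim 4 K * \sum_(r < K) s r * (o 1 r + o 3 r)) => //.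
have ug := unit1_inO (unit1_gauss_lim K (isT : 0 < 4)%N).
apply: eqO_trans (v_second_form K) _.
rewrite expr2 -mulrA -mulrDr; apply: eqOM; [exact: inO_poly | | exact: eqO_refl |].
  apply: inOD; first by rewrite /odd_part; local_ring.
  by apply: (@inOM 0 0); [exact: inO_poly | exact: evenO_inO ev].
rewrite (eq_bigr _ (fun (k : 'I_K) _ => second_formE k)).
apply: eqO_trans (@sum_bailey_lim 1 3 K isT isT) _.
rewrite mulrCA /odd_part -mulrDr; apply: eqOM => //; first 2 [exact: eqO_refl].
  apply: inOD; first by local_ring.
  by apply: (@inOM 0 0); [exact: inO_poly | exact: evenO_inO es].
rewrite mulr_sumr.
rewrite (eq_bigr (fun r : 'I_K => (-1) ^+ r * (q ^+ 8) ^+ 'C(r.+1, 2)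
     * lerch (q ^+ 2) (q ^+ 6) (q ^+ 8) r + q * (s r * (o 1 r + o 3 r)))).
  rewrite big_split; apply: eqOD; last exact: eqO_refl.
  exact: (@lerch_sum_product 2 6).
move=> r _; rewrite (lerch_even_odd _ (z := q ^+ 1)) -?exprD //; first last.
- by apply/unit1_neq0/un.
- by apply/unit1_neq0/un.
rewrite mulrDr; congr (_ * _ * _ + _).
  rewrite -!exprM; congr (_ ^+ _); elim: (nat_of_ord r) => // k IH.
  by rewrite binS bin1; lia.
- by rewrite -!exprM.
have qo a : (0 < a)%N ->
    q * o a r = q ^+ a * (q ^+ 4) ^+ r / (1 - (q ^+ a * (q ^+ 4) ^+ r) ^+ 2).
  by move=> ha; rewrite /o mulrA [q * _]mulrA -exprS subn1 prednK.
by rewrite [RHS]mulrCA [X in _ = _ * X]mulrDr !qo.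
Qed.

(** * The generating function of the signed coloured partitions *)

Definition admissible n (p : cpart n) (k : nat) : bool :=
  ((0 < k) ==> (0 < p.1) && (p.2 < ncolours p.1))%N && ((4 %| p.1) ==> (k <= 1))%N.

Definition part_gf n (p : cpart n) : {poly int} :=
  \sum_(k < n.+1 | admissible p k) (-1) ^+ ((4 %| p.1) * k)%N *: 'X^(k * p.1).

(** Expanding the product means choosing a multiplicity for every coloured
    part, that is, a multiplicity function m, whose weight is the sign
    (-1)^(nparts_mult4 m). *)
Lemma Pv_gf n :
  (Pv_de n)%:Z - (Pv_do n)%:Z = (\prod_(p : cpart n) part_gf p)`_n.
Proof.
have -> : \prod_(p : cpart n) part_gf p =
  \sum_(m : {ffun cpart n -> 'I_n.+1} | [forall p, admissible p (m p)])
     (-1) ^+ nparts_mult4 m *: 'X^(\sum_p m p * p.1).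
  rewrite /part_gf (bigA_distr_big_dep (fun p (k : 'I_n.+1) => admissible p k)).
  apply: eq_big => [m|m _]; first by apply/familyP/forallP.
  rewrite scaler_prod -!expr_sum /nparts_mult4 [in RHS]big_mkcond.
  by congr (_ ^+ _ *: _); apply: eq_bigr => p _; case: (4 %| p.1)%N; rewrite ?mul1n.
rewrite coef_sum /Pv_de /Pv_do -!sum1dep_card !(big_morph Posz PoszD (erefl _)).
rewrite big_mkcond [X in _ - X]big_mkcond -sumrB [RHS]big_mkcond.
apply: eq_bigr => m _; rewrite coefZ coefXn eq_sym.
have -> : is_Pv_partition m =
    ((\sum_p m p * p.1)%N == n) && [forall p, admissible p (m p)].
  rewrite /is_Pv_partition; congr (_ && _); apply/andP/forallP.
    by case=> /forallP h1 /forallP h2 p; apply/andP.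
  by move=> h; split; apply/forallP => p; case/andP: (h p).
case: [forall p, _]; rewrite ?andbF ?andbT //=.
case: (_ == n); rewrite ?mulr0 //= mulr1 -signr_odd.
by case: (odd _).
Qed.

(** The factor contributed by all parts of size s, at q^2 in place of q. *)
Definition part_factor (s : nat) : ratfun :=
  if s == 0%N then 1
  else if (4 %| s)%N then 1 - q ^+ s.*2 else (1 - q ^+ s.*2)^-1 ^+ ncolours s.

Lemma unit1_part_factor s : unit1 (part_factor s).
Proof.
rewrite /part_factor; case: eqP => [_|/eqP s0]; first exact: eqO_refl.
have u : unit1 (1 - q ^+ s.*2) by apply: unit1_1Bexp; lia.
by case: ifP => // _; apply/unit1X/unit1V.
Qed.

Lemma part_factor_tail M s : (M <= s.*2)%N -> eqO M (part_factor s) 1.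
Proof.
move=> le; rewrite /part_factor; case: eqP => [_|/eqP s0]; first exact: eqO_refl.
have u : unit1 (1 - q ^+ s.*2) by apply: unit1_1Bexp; lia.
have h : eqO M (1 - q ^+ s.*2) 1 by apply: eqO_1Bexp.
case: ifP => // _; elim: (ncolours s) => [|k IH]; first exact: eqO_refl.
rewrite exprS -[X in eqO _ _ X]mulr1; apply: eqOM IH.
- exact: unit1V_inO.
- exact: inO1.
by rewrite -[X in eqO _ _ X]invr1; apply: eqOV => //; exact: eqO_refl.
Qed.

(** Each block of sizes 4k+1, ..., 4k+4 contributes one factor to each of the
    four shifted factorials. *)
Lemma prod_part_factor K :
  \prod_(s < (4 * K).+1) part_factor s = poch (q ^+ 8) (q ^+ 8) K
    / (poch (q ^+ 2) (q ^+ 8) K * poch (q ^+ 6) (q ^+ 8) K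
       * poch (q ^+ 4) (q ^+ 8) K ^+ 2).
Proof.
elim: K => [|K IH].
  by rewrite muln0 big_ord_recr big_ord0 !poch0 expr1n !mulr1 divr1 /= mul1r.
have -> : (4 * K.+1 = (4 * K).+4)%N by lia.
rewrite 4!big_ord_recr /= IH.
rewrite /part_factor /=.
have -> : (4 %| (4 * K).+1)%N = false by lia.
have -> : (4 %| (4 * K).+2)%N = false by lia.
have -> : (4 %| (4 * K).+3)%N = false by lia.
have -> : (4 %| (4 * K).+4)%N = true by lia.
have -> : ncolours (4 * K).+1 = 1%N by rewrite /ncolours; case: eqP => //; lia.
have -> : ncolours (4 * K).+2 = 2%N by rewrite /ncolours; case: eqP => //; lia.
have -> : ncolours (4 * K).+3 = 1%N by rewrite /ncolours; case: eqP => //; lia.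
rewrite !pochS -!exprM -!exprD.
have -> : ((4 * K).+1.*2 = 2 + 8 * K)%N by lia.
have -> : ((4 * K).+2.*2 = 4 + 8 * K)%N by lia.
have -> : ((4 * K).+3.*2 = 6 + 8 * K)%N by lia.
have -> : ((4 * K).+4.*2 = 8 + 8 * K)%N by lia.
rewrite !exprMn expr2 !expr1 !invfM.
move: (1 - q ^+ (2 + _)) (1 - q ^+ (4 + _)) (1 - q ^+ (6 + _)) (1 - q ^+ (8 + _)).
move: (poch (q ^+ 8) _ _) (poch (q ^+ 2) _ _) (poch (q ^+ 4) _ _) (poch (q ^+ 6) _ _).
move=> a b c d e f g h.
ring.
Qed.

(** The two products differ by (P;P)_(2K) / (P;P)_K and by the last factor
    of (P;P)_(2K+1), both congruent to 1.  This uses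
    (-P;P)_K (P;P)_K = (P^2;P^2)_K and (P;P)_(2K) = (P;P^2)_K (P^2;P^2)_K. *)
Lemma odd_part_prod K : eqO K (odd_part K) (\prod_(s < (4 * K).+1) part_factor s).
Proof.
rewrite prod_part_factor.
set T := (_ / _); have uT : unit1 T by rewrite /T; local_ring.
have -> : odd_part K = T *
   (poch (q ^+ 4) (q ^+ 4) K.*2
     / (poch (q ^+ 4) (q ^+ 4) K * (1 - q ^+ (4 + 4 * K.*2)))).
  have e8 : (q ^+ 4) ^+ 2 = q ^+ 8 by rewrite -exprM.
  have e1 : poch (- q ^+ 4) (q ^+ 4) K * poch (q ^+ 4) (q ^+ 4) K =
            poch (q ^+ 8) (q ^+ 8) K.
    rewrite /poch -big_split /=; apply: eq_bigr => k _.
    rewrite mulNr opprK mulrC -subr_sqr expr1n; congr (1 - _).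
    by rewrite -!exprM -!exprD -exprM; congr (q ^+ _); lia.
  have e2 : poch (q ^+ 4) (q ^+ 4) K.*2 =
            poch (q ^+ 4) (q ^+ 8) K * poch (q ^+ 8) (q ^+ 8) K.
    by rewrite poch_double e8 -exprD.
  rewrite /odd_part /T /gauss_lim pochS -exprM -exprD e2 -e1.
  have := @unit1_poch 4 4 K isT; have := @unit1_poch 4 8 K isT.
  have := @unit1_poch 2 8 K isT; have := @unit1_poch 6 8 K isT.
  have : unit1 (1 - q ^+ (4 + 4 * K.*2)) by exact: unit1_1Bexp.
  have := @unit1_pochN 4 4 K isT.
  move=> /unit1_neq0 + /unit1_neq0 + /unit1_neq0 +.
  move=> h1 h2 h3 /unit1_neq0 h4 /unit1_neq0 h5 /unit1_neq0 h6; move: h1 h2 h3 h4 h5 h6.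
  have alg (F : fieldType) (a b c d e f : F) :
    a != 0 -> b != 0 -> c != 0 -> d != 0 -> e != 0 -> f != 0 ->
    a / (e * (a * f) * b) * ((a * f) ^+ 2 / (d * c))
    = a * f / (d * c * e ^+ 2) * (e * (a * f) / (f * b)).
    by move=> h1 h2 h3 h4 h5 h6; field; rewrite h1 h2 h3 h4 h5 h6.
  move: (poch (- q ^+ 4) _ _) (1 - q ^+ (4 + 4 * K.*2)) (poch (q ^+ 6) _ _)
    (poch (q ^+ 2) _ _) (poch (q ^+ 4) (q ^+ 8) _) (poch (q ^+ 4) (q ^+ 4) _).
  exact: alg.
rewrite -[X in eqO _ _ X]mulr1.
apply: eqOM; [exact: unit1_inO | exact: inO1 | exact: eqO_refl |].
have u : unit1 (poch (q ^+ 4) (q ^+ 4) K) by local_ring.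
have u' : unit1 (1 - q ^+ (4 + 4 * K.*2)) by exact: unit1_1Bexp.
rewrite -[X in eqO _ _ X](divff (unit1_neq0 u)).
apply: eqOM; [by local_ring | by local_ring | | ].
  by apply: eqO_le (@eqO_poch 4 K _ _ _); lia.
apply: eqOV => //; first exact: unit1M.
rewrite -[X in eqO _ _ X]mulr1.
apply: eqOM; [exact: unit1_inO | exact: inO1 | exact: eqO_refl |].
by apply: eqO_1Bexp; lia.
Qed.

Lemma eqO_prod M (I : Type) (s : seq I) (P : pred I) (f g : I -> ratfun) :
  (forall i, P i -> unit1 (g i)) -> (forall i, P i -> inO 0 (f i)) ->
  (forall i, P i -> eqO M (f i) (g i)) ->
  eqO M (\prod_(i <- s | P i) f i) (\prod_(i <- s | P i) g i).
Proof.
move=> hg hf h; elim: s => [|i s IH]; first by rewrite !big_nil; exact: eqO_refl.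
rewrite !big_cons; case: ifP => // Pi; apply: eqOM (IH); [exact: hf | | exact: h].
exact/unit1_inO/unit1_prod.
Qed.

(** The factor contributed by one coloured part, at q^2 in place of q; it is 1
    for the pairs that are not coloured parts. *)
Definition cpart_factor n (p : cpart n) : ratfun :=
  if (0 < p.1)%N && (p.2 < ncolours p.1)%N then
    if (4 %| p.1)%N then 1 - q ^+ p.1.*2 else (1 - q ^+ p.1.*2)^-1
  else 1.

Lemma unit1_cpart_factor n (p : cpart n) : unit1 (cpart_factor p).
Proof.
rewrite /cpart_factor; case: ifP => [/andP[s0 _]|_]; last exact: eqO_refl.
have u : unit1 (1 - q ^+ p.1.*2) by apply: unit1_1Bexp; lia.
by case: ifP => // _; exact: unit1V.
Qed.

(** For a part that may be repeated, the multiplicities are cut at n, which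
    only affects q^(2s(n+1)) and beyond, for the size s >= 1. *)
Lemma part_gf_factor n (p : cpart n) :
  eqO n.*2.+2 (part_gf p \Po 'X^2)%:F (cpart_factor p).
Proof.
have e : (part_gf p \Po 'X^2)%:F =
    \sum_(k < n.+1 | admissible p k) (-1) ^+ ((4 %| p.1) * k)%N * q ^+ (p.1.*2 * k).
  rewrite /part_gf !rmorph_sum /=; apply: eq_bigr => k _.
  rewrite -mul_polyC rmorphM /= comp_polyC comp_Xn_poly tofracM -exprM tofracXn.
  congr (_ * _); last by congr (_ ^+ _); lia.
  by rewrite !rmorphXn !rmorphN !rmorph1.
rewrite {}e /cpart_factor /admissible.
case: ifP => [/andP[s0 _]|bad]; last first.
  rewrite (big_pred1 ord0) ?muln0 ?expr0 ?mulr1; first exact: eqO_refl.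
  move=> k /=; rewrite -val_eqE /=.
  by case: (nat_of_ord k) => [|j] //=; rewrite implybT.
have ltsn := ltn_ord p.1.
case: ifP => d4.
  case: n p s0 ltsn d4 => [|n] p s0 ltsn d4; first by move: ltsn s0; lia.
  rewrite big_mkcond !big_ord_recl /= big1 ?addr0 => [|k _]; last by rewrite ?andbF.
  rewrite (_ : bump 0 0 = 1%N) // !muln0 !muln1 !expr0 expr1 mul1r mulN1r.
  exact: eqO_refl.
have u : unit1 (1 - q ^+ p.1.*2) by apply: unit1_1Bexp; lia.
rewrite (eq_big xpredT (fun k : 'I_n.+1 => (q ^+ p.1.*2) ^+ k)); first last.
- by move=> k _; rewrite mul0n mul1r exprM.
- by move=> k; rewrite implybT.
have -> : \sum_(k < n.+1) (q ^+ p.1.*2) ^+ k =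
    (1 - (q ^+ p.1.*2) ^+ n.+1) * (1 - q ^+ p.1.*2)^-1.
  apply: (canRL (mulfK (unit1_neq0 u))).
  by rewrite mulrC -opprB mulNr -subrX1 opprB.
rewrite -[X in eqO _ _ X]mul1r; apply: eqOM.
- by rewrite -exprM; local_ring; lia.
- exact: unit1V_inO.
- by rewrite -exprM; apply: eqO_1Bexp; nia.
- exact: eqO_refl.
Qed.

Lemma prod_cpart_factor n :
  \prod_(p : cpart n) cpart_factor p = \prod_(s < n.+1) part_factor s.
Proof.
rewrite -(pair_bigA _ (fun s c => cpart_factor (s, c))) /=; apply: eq_bigr => s _.
rewrite !big_ord_recr big_ord0 /= mul1r /cpart_factor /part_factor /=.
case: (posnP s) => [-> | s0] /=; first by rewrite mul1r.
rewrite /ncolours; case: eqP => [s2|_] /=; last by rewrite mulr1; case: ifP.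
have -> : (4 %| s)%N = false by lia.
by rewrite expr2.
Qed.

Lemma part_factor_truncate n L : (n <= L)%N ->
  eqO n.*2.+2 (\prod_(s < L.+1) part_factor s) (\prod_(s < n.+1) part_factor s).
Proof.
elim: L => [|L IH]; first by rewrite leqn0 => /eqP ->; exact: eqO_refl.
rewrite leq_eqVlt => /orP[/eqP ->|lt]; first exact: eqO_refl.
rewrite big_ord_recr -[X in eqO _ _ X]mulr1 /=.
apply: eqOM; [| exact: inO1 | exact: IH |].
  by apply/unit1_inO/unit1_prod => i _; exact: unit1_part_factor.
by apply: part_factor_tail; lia.
Qed.

Lemma odd_part_gf n K : (n.*2.+2 <= K)%N ->
  eqO n.*2.+2 (odd_part K) ((\prod_(p : cpart n) part_gf p) \Po 'X^2)%:F.
Proof.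
move=> le; apply: eqO_trans (eqO_le le (odd_part_prod K)) _.
apply: eqO_trans (@part_factor_truncate n (4 * K) _) _; first by lia.
rewrite -prod_cpart_factor !rmorph_prod /=; apply: eqO_sym; apply: eqO_prod => p _.
- exact: unit1_cpart_factor.
- exact: inO_poly.
- exact: part_gf_factor.
Qed.

Theorem theorem3p2 (Pv : nat -> int) (hPv : is_fps_sum v_term Pv) (n : nat) :
  Pv (2 * n + 1)%N = (Pv_de n)%:Z - (Pv_do n)%:Z.
Proof.
(* K exceeds both the stabilisation rank of the coefficient and its degree. *)
have [M hM] := hPv (2 * n + 1)%N.
pose K := (M + n.*2.+2)%N; rewrite -(hM K) ?leq_addr // Pv_gf.
set G := \prod_(p : cpart n) part_gf p.
have le : (n.*2.+2 <= K)%N by exact: leq_addl.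
have [e [h he] hS] := v_even_odd K.
have hX : eqO (2 * n + 1).+1 (\sum_(k < K) (v_num k)%:F / (v_den k)%:F)
    ('X * (G \Po 'X^2) + 'X^2 * (h \Po 'X^2))%:F.
  have -> : ((2 * n + 1).+1 = n.*2.+2)%N by lia.
  apply: eqO_trans (eqO_le le hS) _.
  rewrite tofracD (tofracM 'X) (tofracM 'X^2) tofracXn.
  apply: eqOD; apply: eqOM; try exact: inO_poly.
  - exact: eqO_refl.
  - exact: odd_part_gf.
  - exact: inO_exp.
  - exact: eqO_refl.
  - exact: eqO_le he.
rewrite [LHS](sum_fps_div _ hX) => [|k]; last exact: qpochX_coef0.
rewrite coefD coefXM coefXnM addn1 /= !coef_comp_poly_Xn //.
rewrite dvdn_mulr // mulKn //; case: ltnP => [_|lt]; first by rewrite addr0.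
have -> : (2 %| (2 * n).+1 - 2)%N = false by lia.
by rewrite addr0.
Qed.
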